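(* Let $n,m,k,p,q$ be positive integers, $A\in\mathbb{R}^{p\times n}$, $B\in\mathbb{R}^{m\times q}$, and $K:=A\otimes B^\top\in\mathbb{R}^{pq\times nm}$, so that $\mathrm{vec}((AXB)^\top)=K\,\mathrm{vec}(X^\top)$ for all $X\in\mathbb{R}^{n\times m}$. For $W_{x,x}\in\mathcal{S}^{nm}$, partition $KW_{x,x}K^\top\in\mathcal{S}^{pq}$ into $p\times p$ blocks of size $q\times q$, and let $\rho_A:=\lambda_{\max}(AA^\top)$. Then the following constraint on $(X,Y,W_{x,x})$ is valid for the mixed-projection problem (P0) defined in the context, and may be imposed in its relaxation (P2) defined in the context: $$\exists\, Z\in\mathrm{Conv}(\mathcal{Y}^k_p)\ \text{ s.t. }\ \begin{pmatrix}\sum_{a=1}^p(KW_{x,x}K^\top)^{(a,a)} & (AXB)^\top \\ AXB & Z\end{pmatrix}\succeq 0,\qquad AYA^\top\preceq\rho_AZ.$$ That is, for every feasible $(X,Y)$ of (P0), the triple $(X,Y,W_{x,x})$ with $W_{x,x}=\mathrm{vec}(X^\top)\mathrm{vec}(X^\top)^\top$ satisfies this constraint (so that (P2) with this constraint added is still a relaxation of (P0)).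
   Context: $\mathcal{S}^d$ (resp. $\mathcal{S}^d_+$) is the set of $d\times d$ real symmetric (resp. positive semidefinite) matrices; $\langle\cdot,\cdot\rangle$ is the trace inner product; $[n]=\{1,\dots,n\}$; $\mathrm{vec}$ stacks columns; $\otimes$ is the Kronecker product; $\lambda_{\max}$ is the largest eigenvalue; $M^{(a,b)}$ is the $(a,b)$ block of a block matrix $M$. $\mathcal{Y}_d^k:=\{Y\in\mathcal{S}^d_+:Y^2=Y,\ \mathrm{tr}(Y)\le k\}$ is the set of $d\times d$ orthogonal projection matrices of rank at most $k$, and $\mathrm{Conv}(\mathcal{Y}_d^k)=\{P\in\mathcal{S}^d_+:P\preceq I_d,\ \mathrm{tr}(P)\le k\}$ is its convex hull. Data: $\lambda\ge0$, $H\in\mathcal{S}^{nm}$, $D\in\mathbb{R}^{n\times m}$, and for $i\in\mathcal{I}$, $Q_i\in\mathcal{S}^{nm}$, $E_i\in\mathbb{R}^{n\times m}$, $b_i\in\mathbb{R}$. Problem (P0): minimize $\lambda\,\mathrm{tr}(Y)+\langle\mathrm{vec}(X^\top)\mathrm{vec}(X^\top)^\top,H\rangle+\langle D,X\rangle$ over $Y\in\mathcal{Y}^k_n$, $X\in\mathbb{R}^{n\times m}$ subject to $\langle Q_i,\mathrm{vec}(X^\top)\mathrm{vec}(X^\top)^\top\rangle+\langle E_i,X\rangle\le b_i$ for all $i\in\mathcal{I}$ and $X=YX$. Problem (P2): minimize $\lambda\,\mathrm{tr}(Y)+\langle W_{x,x},H\rangle+\langle D,X\rangle$ over $Y\in\mathcal{S}^n_+$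 with $Y\preceq I_n$, $\mathrm{tr}(Y)\le k$, $X\in\mathbb{R}^{n\times m}$, $W_{x,x}\in\mathcal{S}^{nm}_+$ subject to $W_{x,x}\succeq\mathrm{vec}(X^\top)\mathrm{vec}(X^\top)^\top$, $\langle Q_i,W_{x,x}\rangle+\langle E_i,X\rangle\le b_i$ for all $i\in\mathcal{I}$, and $\begin{pmatrix}\sum_{i\in[n]}W_{x,x}^{(i,i)} & X^\top \\ X & Y\end{pmatrix}\succeq0$, where $W_{x,x}$ is partitioned into $n\times n$ blocks of size $m\times m$. *)

(* Defs.v *)
(* MathComp-Analysis, over an arbitrary R : realType. *)
From mathcomp Require Import all_boot all_order all_algebra.
From mathcomp Require Import mxtens.
From mathcomp Require Import all_classical all_reals convex.

Set Implicit Arguments.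
Unset Strict Implicit.
Unset Printing Implicit Defensive.

Import Order.TTheory GRing.Theory Num.Theory.
Local Open Scope classical_set_scope.
Local Open Scope ring_scope.

Section Matrices.
Context {R : realType}.

Definition psd {d} (M : 'M[R]_d) : Prop :=
  M \is symmetricmx /\ forall v : 'cV[R]_d, 0 <= (v^T *m M *m v) 0 0.

Definition loewner_le {d} (M N : 'M[R]_d) : Prop := psd (N - M).

Definition inner {r c} (M N : 'M[R]_(r, c)) : R := \tr (M^T *m N).

(* Columns stacked: entry (i, j) of M sits at position j * r + i, the row-major
   position of (j, i) in 'I_(c * r) used by the Kronecker product [tensmx]. *)
Definition vec {r c} (M : 'M[R]_(r, c)) : 'cV[R]_(c * r) :=
  \col_l M (mxtens_unindex l).2 (mxtens_unindex l).1.

(* vec(X^T) vec(X^T)^T *)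
Definition lift_mx {n m} (X : 'M[R]_(n, m)) : 'M[R]_(n * m) :=
  vec X^T *m (vec X^T)^T.

(* The (a, b) block, of size m x m, of a matrix seen as n x n blocks. *)
Definition block {n m} (W : 'M[R]_(n * m)) (a b : 'I_n) : 'M[R]_m :=
  \matrix_(i, j) W (mxtens_index (a, i)) (mxtens_index (b, j)).

(* As a supremum so as to be total; a symmetric matrix of positive size has
   finitely many eigenvalues, and at least one, so there it is a maximum. *)
Definition lambda_max {d} (M : 'M[R]_d) : R := sup [set a | eigenvalue M a].

Definition proj_le_rank (d k : nat) : set 'M[R]_d :=
  [set Y | [/\ psd Y, Y *m Y = Y & \tr Y <= k%:R]].

Definition convex_hull {V : lmodType R} (C : set V) : set V :=
  smallest (@convex_set R V) C.

End Matrices.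

Section Problems.
Context {R : realType} {n m : nat} {I : Type}.
Variables (k : nat) (lam : R) (H : 'M[R]_(n * m)) (D : 'M[R]_(n, m)).
Variables (Q : I -> 'M[R]_(n * m)) (E : I -> 'M[R]_(n, m)) (b : I -> R).

Definition P0_objective (X : 'M[R]_(n, m)) (Y : 'M[R]_n) : R :=
  lam * \tr Y + inner (lift_mx X) H + inner D X.

Definition P0_feasible (X : 'M[R]_(n, m)) (Y : 'M[R]_n) : Prop :=
  [/\ proj_le_rank k Y,
      forall i, inner (Q i) (lift_mx X) + inner (E i) X <= b i
    & X = Y *m X].

Definition P2_objective
    (X : 'M[R]_(n, m)) (Y : 'M[R]_n) (W : 'M[R]_(n * m)) : R :=
  lam * \tr Y + inner W H + inner D X.

Definition P2_feasible
    (X : 'M[R]_(n, m)) (Y : 'M[R]_n) (W : 'M[R]_(n * m)) : Prop :=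
  [/\ [/\ psd Y, loewner_le Y 1%:M & \tr Y <= k%:R],
      psd W,
      loewner_le (lift_mx X) W,
      forall i, inner (Q i) W + inner (E i) X <= b i
    & psd (block_mx (\sum_(i < n) block W i i) X^T X Y)].

End Problems.

Definition kron_cut {R : realType} {n m p q : nat} (k : nat)
    (A : 'M[R]_(p, n)) (B : 'M[R]_(m, q))
    (X : 'M[R]_(n, m)) (Y : 'M[R]_n) (W : 'M[R]_(n * m)) : Prop :=
  let K := A *t B^T in
  let rho := lambda_max (A *m A^T) in
  exists Z : 'M[R]_p,
    [/\ convex_hull (@proj_le_rank R p k) Z,
        psd (block_mx (\sum_(a < p) block (K *m W *m K^T) a a)
                      (A *m X *m B)^T (A *m X *m B) Z)
      & loewner_le (A *m Y *m A^T) (rho *: Z)].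

(* Main.v *)
Require Import Defs.
From mathcomp Require Import all_boot all_order all_algebra.
From mathcomp Require Import mxtens.
From mathcomp Require Import all_classical all_reals convex.
From mathcomp Require Import ring lra.

(** The cut is certified by an explicit Z, the orthogonal projector onto the
column space of A Y.  Its trace is its rank, rank (A Y) <= rank Y = tr Y <= k,
so Z lies in the hull as one of its generators.

Since X = Y X, the matrix V = A X B = (A Y) X B is fixed by Z.  When W is the
rank-one lift of X, the identity vec ((A X B)^T) = K vec (X^T) makes K W K^T the
rank-one lift of V, whose diagonal blocks sum to V^T V; the block matrix is then
the Gram matrix of the columns of [V Z], because Z is a symmetric idempotent
with Z V = V ([proj_block_psd]).  Taking A and B to be identities, so that Z is
Y and V is X, the same remark gives the semidefinite constraint of the
relaxation.

For the Loewner bound, Z A Y = A Y gives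
  rho Z - A Y A^T = Z (rho I - A A^T) Z + N N^T,   N = Z A (I - Y),
so everything rests on A A^T <= rho I.  This bound of a symmetric M by its
largest eigenvalue ([loewner_le_lambda_max]) is obtained without diagonalising:
let r be the least t with M <= t I.  If r I - M were invertible it would be
bounded below by some c I with c > 0 ([psd_unit_coercive]), and r - c would be a
smaller such t; hence r is an eigenvalue, and the bound M <= r I makes it the
largest one. *)

Set Implicit Arguments.
Unset Strict Implicit.

Import Order.TTheory GRing.Theory Num.Theory.
Local Open Scope ring_scope.

(** * Positive semidefinite matrices *)

Lemma symmetricmxE (R : realType) d (M : 'M[R]_d) :
  (M \is symmetricmx) = (M^T == M).
Proof.
by rewrite is_hermitianmxE expr0 scale1r map_mx_id // eq_sym.
Qed.

Lemma psd_tr (R : realType) d (M : 'M[R]_d) : psd M -> M^T = M.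
Proof. by case; rewrite symmetricmxE => /eqP. Qed.

Lemma normsqE (R : realType) d (v : 'cV[R]_d) :
  (v^T *m v) 0 0 = \sum_i v i 0 ^+ 2.
Proof. by rewrite mxE; apply: eq_bigr => i _; rewrite mxE expr2. Qed.

Lemma normsq_ge0 (R : realType) d (v : 'cV[R]_d) : 0 <= (v^T *m v) 0 0.
Proof. by rewrite normsqE sumr_ge0 // => i _; rewrite sqr_ge0. Qed.

Lemma normsq_eq0 (R : realType) d (v : 'cV[R]_d) :
  (v^T *m v) 0 0 = 0 -> v = 0.
Proof.
rewrite normsqE => /psumr_eq0P v0; apply/colP => i; rewrite mxE.
by apply/eqP; rewrite -sqrf_eq0 v0 // => j _; rewrite sqr_ge0.
Qed.

Lemma psd_congr (R : realType) d e (N : 'M[R]_(e, d)) (M : 'M[R]_d) :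
  psd M -> psd (N *m M *m N^T).
Proof.
move=> M_psd; split.
  by rewrite symmetricmxE !trmx_mul trmxK (psd_tr M_psd) mulmxA.
move=> v; have [_ /(_ (N^T *m v))] := M_psd.
by rewrite trmx_mul trmxK !mulmxA.
Qed.

Lemma psd1 (R : realType) d : psd (1%:M : 'M[R]_d).
Proof.
split=> [|v]; first by rewrite symmetricmxE trmx1.
by rewrite mulmx1 normsq_ge0.
Qed.

Lemma psd_gram (R : realType) d e (N : 'M[R]_(d, e)) : psd (N *m N^T).
Proof. by have := psd_congr N (psd1 R e); rewrite mulmx1. Qed.

Lemma psd_add (R : realType) d (M N : 'M[R]_d) :
  psd M -> psd N -> psd (M + N).
Proof.
move=> Mp Np; split=> [|v].
  by rewrite symmetricmxE linearD /= !psd_tr.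
by rewrite mulmxDr mulmxDl mxE addr_ge0 //; [case: Mp|case: Np].
Qed.

Lemma loewner_le_refl (R : realType) d (M : 'M[R]_d) : loewner_le M M.
Proof.
rewrite /loewner_le subrr; split=> [|v]; first by rewrite symmetricmxE trmx0.
by rewrite mulmx0 mul0mx mxE.
Qed.

(** * Orthogonal projectors *)

Lemma proj_psd (R : realType) d (Y : 'M[R]_d) :
  Y^T = Y -> Y *m Y = Y -> psd Y.
Proof. by move=> sY iY; rewrite -iY -{2}sY; exact: psd_gram. Qed.

Lemma proj_compl (R : realType) d (Y : 'M[R]_d) :
  Y^T = Y -> Y *m Y = Y ->
  (1%:M - Y)^T = 1%:M - Y /\ (1%:M - Y) *m (1%:M - Y) = 1%:M - Y.
Proof.
move=> sY iY; split; first by rewrite linearB /= trmx1 sY.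
by rewrite mulmxBl mul1mx mulmxBr mulmx1 iY subrr subr0.
Qed.

(** A rank factorisation Y = L U of an idempotent has U L = 1, and the trace is
cyclic. *)
Lemma mxtrace_idempotent (R : realType) d (Y : 'M[R]_d) :
  Y *m Y = Y -> \tr Y = (\rank Y)%:R.
Proof.
move=> iY.
have rc1 : row_base Y *m col_base Y = 1%:M.
  apply: (row_free_inj (row_base_free Y)); apply: (row_full_inj (col_base_full Y)).
  rewrite /= mul1mx.
  by rewrite 2!mulmxA mulmx_base -mulmxA mulmx_base.
by rewrite -{1}(mulmx_base Y) mxtrace_mulC rc1 mxtrace1.
Qed.

(** Over the reals w U U^T = 0 forces |w U|^2 = 0. *)
Lemma gram_unitmx (R : realType) r d (U : 'M[R]_(r, d)) :
  row_free U -> U *m U^T \in unitmx.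
Proof.
move=> freeU; rewrite -row_free_unit -kermx_eq0; apply/rowV0P => w /sub_kermxP w0.
have /normsq_eq0/eqP : ((w *m U)^T^T *m (w *m U)^T) 0 0 = 0.
  by rewrite trmxK trmx_mul mulmxA -[w *m U *m _]mulmxA w0 mul0mx mxE.
rewrite trmx_eq0 => /eqP wU0; apply: (row_free_inj freeU).
by rewrite wU0 mul0mx.
Qed.

(** With C = U^T L a rank factorisation, this is the least-squares projector
U^T (U U^T)^-1 U. *)
Lemma orthogonal_projector (R : realType) d e (C : 'M[R]_(d, e)) :
  exists Z : 'M[R]_d,
    [/\ Z^T = Z, Z *m Z = Z, Z *m C = C & \rank Z = \rank C].
Proof.
have [r [U [L [freeU CE rE]]]] : exists r, exists U : 'M[R]_(r, d),
    exists L : 'M[R]_(r, e), [/\ row_free U, C = U^T *m L & r = \rank C].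
  exists (\rank C^T), (row_base C^T), (col_base C^T)^T; split.
  - exact: row_base_free.
  - by rewrite -trmx_mul mulmx_base trmxK.
  - by rewrite mxrank_tr.
pose G := invmx (U *m U^T).
have sG : G^T = G by rewrite /G trmx_inv trmx_mul trmxK.
have ZUt : U^T *m G *m U *m U^T = U^T.
  by rewrite -mulmxA -[_ *m _ *m (U *m _)]mulmxA mulVmx ?mulmx1 ?gram_unitmx.
have ZC : U^T *m G *m U *m C = C by rewrite CE mulmxA ZUt.
exists (U^T *m G *m U); split; [| |exact: ZC|].
- by rewrite !trmx_mul sG trmxK mulmxA.
- by rewrite mulmxA [U^T *m G *m U *m _]mulmxA ZUt.
- apply/eqP; rewrite eqn_leq; apply/andP; split; last first.
    by rewrite -{1}ZC mxrankM_maxl.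
  by rewrite (leq_trans (mxrankM_maxr _ _)) // -rE rank_leq_row.
Qed.

(** * The largest eigenvalue as a Loewner bound *)

Lemma form_bounded (R : realType) d (M : 'M[R]_d) :
  exists2 c : R, 0 < c &
    forall v : 'cV[R]_d, (v^T *m M *m v) 0 0 <= c * (v^T *m v) 0 0.
Proof.
pose c : R := \sum_i \sum_j `|M j i|.
have c_ge0 : 0 <= c by rewrite sumr_ge0 // => i _; rewrite sumr_ge0.
(* The sum of moduli vanishes with M, hence the added 1. *)
exists (c + 1) => [|v]; first lra.
have sq_le i : v i 0 ^+ 2 <= (v^T *m v) 0 0.
  rewrite normsqE (bigD1 i) //= lerDl sumr_ge0 // => j _; exact: sqr_ge0.
have le_c : (v^T *m M *m v) 0 0 <= c * (v^T *m v) 0 0; last first.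
  by rewrite mulrDl mul1r (le_trans le_c) // lerDl normsq_ge0.
rewrite mxE mulr_suml; apply: ler_sum => i _.
rewrite mxE !mulr_suml; apply: ler_sum => j _; rewrite [v^T _ _]mxE.
rewrite (le_trans (ler_norm _)) // mulrAC mulrC normrM ler_wpM2l //.
have amgm (x y t : R) : x ^+ 2 <= t -> y ^+ 2 <= t -> `|x * y| <= t.
  by move=> xt yt; rewrite ler_norml; apply/andP; split; nra.
exact: (amgm _ _ _ (sq_le j) (sq_le i)).
Qed.

(** Substitute for a spectral gap: evaluate the form at v - t P^-1 v, with t
chosen against a bound c |v|^2 for the form of P^-1. *)
Lemma psd_unit_coercive (R : realType) d (P : 'M[R]_d) :
  psd P -> P \in unitmx ->
  exists2 c : R, 0 < c &
    forall v : 'cV[R]_d, c * (v^T *m v) 0 0 <= (v^T *m P *m v) 0 0.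
Proof.
move=> Pp uP; have [c c_gt0 hc] := form_bounded (invmx P).
exists c^-1 => [|v]; first by rewrite invr_gt0.
(* t = c^-1 maximises the gain 2 t - c t^2. *)
pose w := v - c^-1 *: (invmx P *m v).
have [_ /(_ w)] := Pp.
have -> : (w^T *m P *m w) 0 0 = (v^T *m P *m v) 0 0
    - c^-1 *+ 2 * (v^T *m v) 0 0 + c^-1 ^+ 2 * (v^T *m invmx P *m v) 0 0.
  have -> : w^T = v^T - c^-1 *: (v^T *m invmx P).
    rewrite [LHS]linearB /= [X in _ - X]linearZ /=.
    by rewrite trmx_mul trmx_inv (psd_tr Pp).
  rewrite mulmxBl mulmxBr !mulmxBl -!scalemxAl -!scalemxAr.
  rewrite -!mulmxA mulKVmx // mulKmx // !mulmxA; clear; rewrite !mxE.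
  ring.
have c2_ge0 : 0 <= c^-1 ^+ 2 by rewrite sqr_ge0.
have := ler_wpM2l c2_ge0 (hc v).
have -> : c^-1 ^+ 2 * (c * (v^T *m v) 0 0) = c^-1 * (v^T *m v) 0 0.
  by field; rewrite gt_eqF.
lra.
Qed.

Lemma loewner_le_scalar (R : realType) d (M : 'M[R]_d) (t : R) :
  M^T = M ->
  loewner_le M t%:M <->
  forall v : 'cV[R]_d, (v^T *m M *m v) 0 0 <= t * (v^T *m v) 0 0.
Proof.
move=> sM.
have E (v : 'cV[R]_d) : (v^T *m (t%:M - M) *m v) 0 0 =
    t * (v^T *m v) 0 0 - (v^T *m M *m v) 0 0.
  by rewrite mulmxBr mulmxBl mul_mx_scalar -scalemxAl !mxE.
split=> [[_ h] v|h]; first by have := h v; rewrite E subr_ge0.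
split=> [|v]; last by rewrite E subr_ge0.
by rewrite symmetricmxE linearB /= tr_scalar_mx sM.
Qed.

(** The eigenvalue is the least t such that M <= t I. *)
Lemma top_eigenvalue (R : realType) d (M : 'M[R]_d) :
  (0 < d)%N -> M^T = M -> exists2 r : R, eigenvalue M r & loewner_le M r%:M.
Proof.
move=> d_gt0 sM.
pose S : set R := [set t | loewner_le M t%:M]%classic.
have S0 : (S !=set0)%classic.
  by have [c _ hc] := form_bounded M; exists c; apply/loewner_le_scalar.
have lbS : has_lbound S.
  pose e : 'cV[R]_d := delta_mx (Ordinal d_gt0) 0.
  exists ((e^T *m M *m e) 0 0) => t /(loewner_le_scalar _ sM)/(_ e).
  by rewrite trmx_delta mul_delta_mx [X in _ * X]mxE !eqxx mulr1.
have Sr : S (inf S).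
  apply/loewner_le_scalar => // v; rewrite leNgt; apply/negP => lt_v.
  have v_gt0 : 0 < (v^T *m v) 0 0.
    rewrite lt_neqAle normsq_ge0 andbT; apply/eqP => /esym/normsq_eq0 v0.
    by move: lt_v; rewrite v0 !mulmx0 mxE mulr0 ltxx.
  rewrite -ltr_pdivlMr // in lt_v.
  have [t /(loewner_le_scalar _ sM)/(_ v)] := inf_lt S0 lt_v.
  by rewrite -ler_pdivrMr // => h1 /(le_lt_trans h1); rewrite ltxx.
exists (inf S) => //.
rewrite /eigenvalue /eigenspace kermx_eq0 row_free_unit; apply/negP => uM.
have uP : (inf S)%:M - M \in unitmx by rewrite -opprB -scaleN1r unitmxZ ?unitrN1.
have [c c_gt0 hc] := psd_unit_coercive Sr uP.
have : S (inf S - c).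
  apply/loewner_le_scalar => // v; have := hc v.
  by rewrite mulmxBr mulmxBl mul_mx_scalar -scalemxAl !mxE; lra.
by move=> /(ge_inf lbS); lra.
Qed.

Lemma loewner_le_lambda_max (R : realType) d (M : 'M[R]_d) :
  (0 < d)%N -> M^T = M -> loewner_le M (lambda_max M)%:M.
Proof.
move=> d_gt0 sM; have [r eig_r Mr] := top_eigenvalue d_gt0 sM.
have ub_r : ubound [set a | eigenvalue M a]%classic r.
  move=> a /eigenvalueP[w wM w_neq0].
  have /(_ w^T) := (loewner_le_scalar _ sM).1 Mr.
  rewrite trmxK wM -scalemxAl mxE ler_pM2r //.
  rewrite -{1}(trmxK w) lt_neqAle normsq_ge0 andbT eq_sym.
  by apply: contra_neq w_neq0 => /normsq_eq0/(congr1 trmx); rewrite trmxK trmx0.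
suff -> : lambda_max M = r by [].
apply/eqP; rewrite eq_le ge_sup //=; last by exists r.
by apply: ub_le_sup => //; exists r.
Qed.

(** * The lifted constraint *)

Lemma vec_kron (R : realType) n m p q (A : 'M[R]_(p, n)) (B : 'M[R]_(m, q))
    (X : 'M[R]_(n, m)) :
  vec (A *m X *m B)^T = (A *t B^T) *m vec X^T.
Proof.
apply/colP => l; case: (mxtens_indexP l) => a j.
rewrite mxE mxtens_indexK !mxE /=.
under eq_bigr => c _ do rewrite mxE mulr_suml.
rewrite exchange_big pair_bigA /=.
rewrite [RHS](reindex (@mxtens_index n m)) /=; last first.
  by exists (@mxtens_unindex n m) => x _; rewrite ?mxtens_indexK ?mxtens_unindexK.
apply: eq_bigr => -[i c] _.
by rewrite tensmxE !mxE mxtens_indexK /= mulrAC.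
Qed.

Lemma sum_block_lift (R : realType) n m (X : 'M[R]_(n, m)) :
  \sum_(i < n) block (lift_mx X) i i = X^T *m X.
Proof.
apply/matrixP => i j; rewrite summxE !mxE; apply: eq_bigr => a _.
by rewrite mxE /lift_mx mxE big_ord1 !mxE !mxtens_indexK.
Qed.

(** Since Z V = V, the block matrix is the Gram matrix (V Z)^T (V Z). *)
Lemma proj_block_psd (R : realType) n m (V : 'M[R]_(n, m)) (Z : 'M[R]_n) :
  Z^T = Z -> Z *m Z = Z -> Z *m V = V ->
  psd (block_mx (\sum_(i < n) block (lift_mx V) i i) V^T V Z).
Proof.
move=> sZ iZ ZV; have VtZ : V^T *m Z = V^T by rewrite -{1}sZ -trmx_mul ZV.
have := psd_gram (col_mx V^T Z).
by rewrite tr_col_mx trmxK mul_col_row sZ iZ ZV VtZ sum_block_lift.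
Qed.

(** Z projects onto the columns of A Y rather than those of A X B: both lie under
the rank bound, but A Y A^T <= rho Z needs Z to fix the larger space. *)
Lemma P0_kron_cut (R : realType) n m k p q (A : 'M[R]_(p, n))
    (B : 'M[R]_(m, q)) (X : 'M[R]_(n, m)) (Y : 'M[R]_n) :
  (0 < p)%N -> proj_le_rank k Y -> X = Y *m X -> kron_cut k A B X Y (lift_mx X).
Proof.
move=> p_gt0 [/psd_tr sY iY trY] XY.
have [Z [sZ iZ ZAY rkZ]] := orthogonal_projector (A *m Y).
have ZV : Z *m (A *m X *m B) = A *m X *m B.
  by rewrite {1}XY !mulmxA -(mulmxA Z) ZAY -(mulmxA A) -XY.
exists Z; split.
- apply: sub_gen_smallest; split=> //; first exact: proj_psd.
  rewrite mxtrace_idempotent // rkZ; apply: le_trans trY.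
  by rewrite mxtrace_idempotent // ler_nat mxrankM_maxr.
- have -> : (A *t B^T) *m lift_mx X *m (A *t B^T)^T = lift_mx (A *m X *m B).
    by rewrite /lift_mx vec_kron trmx_mul !mulmxA.
  exact: proj_block_psd.
set rho := lambda_max _; pose N := Z *m A *m (1%:M - Y).
have AYZ : A *m Y *m A^T *m Z = A *m Y *m A^T.
  apply: trmx_inj; rewrite !trmx_mul sZ trmxK sY !mulmxA.
  by rewrite -(mulmxA Z) ZAY.
rewrite /loewner_le.
have -> : rho *: Z - A *m Y *m A^T =
    Z *m (rho%:M - A *m A^T) *m Z^T + N *m N^T.
  have [sY1 iY1] := proj_compl sY iY.
  have -> : N *m N^T = Z *m (A *m A^T) *m Z - Z *m (A *m Y) *m A^T *m Z.
    rewrite /N !trmx_mul sY1 sZ !mulmxA.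
    by rewrite -(mulmxA (Z *m A) (1%:M - Y)) iY1 mulmxBr mulmx1 !mulmxBl.
  rewrite ZAY AYZ sZ mulmxBr mulmxBl mul_mx_scalar -scalemxAl iZ.
  by rewrite addrA subrK.
apply: psd_add; last exact: psd_gram.
apply: psd_congr; apply: loewner_le_lambda_max => //.
by rewrite trmx_mul trmxK.
Qed.

Unset Implicit Arguments.

Theorem theorem2 (R : realType) (n m k p q : nat)
    (n_gt0 : (0 < n)%N) (m_gt0 : (0 < m)%N) (k_gt0 : (0 < k)%N)
    (p_gt0 : (0 < p)%N) (q_gt0 : (0 < q)%N)
    (I : Type) (lam : R) (H : 'M[R]_(n * m)) (D : 'M[R]_(n, m))
    (Q : I -> 'M[R]_(n * m)) (E : I -> 'M[R]_(n, m)) (b : I -> R)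
    (lam_ge0 : 0 <= lam) (H_sym : H \is symmetricmx)
    (Q_sym : forall i, Q i \is symmetricmx)
    (A : 'M[R]_(p, n)) (B : 'M[R]_(m, q)) :
  [/\ forall X : 'M[R]_(n, m),
        vec (A *m X *m B)^T = (A *t B^T) *m vec X^T,
      forall (X : 'M[R]_(n, m)) (Y : 'M[R]_n),
        P0_feasible k Q E b X Y -> kron_cut k A B X Y (lift_mx X)
    & forall (X : 'M[R]_(n, m)) (Y : 'M[R]_n),
        P0_feasible k Q E b X Y ->
        [/\ P2_feasible k Q E b X Y (lift_mx X),
            kron_cut k A B X Y (lift_mx X)
          & P2_objective lam H D X Y (lift_mx X) = P0_objective lam H D X Y]].
Proof.
have cut X Y : P0_feasible k Q E b X Y -> kron_cut k A B X Y (lift_mx X).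
  by case=> pY _ XY; exact: P0_kron_cut.
split=> // [X|X Y feas]; first exact: vec_kron.
split=> //; last exact: cut.
have [[Yp iY trY] cons XY] := feas; have sY := psd_tr Yp.
split=> //.
- by have [sY1 iY1] := proj_compl sY iY; split=> //; exact: proj_psd.
- exact: psd_gram.
- exact: loewner_le_refl.
- exact: proj_block_psd.
Qed.
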